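(* Consider the convection-diffusion problem with nonlocal diffusion $u_t+f(u)_x+\sigma\mathcal{L}_\delta u=f_s$ for $x\in\Omega$, $t>0$, $u(x,0)=u_0(x)$, with periodic or compactly supported boundary conditions, where $f_s=f_s(x,t)$ is a source function, and the semi-discrete DG method: seek $u_h(\cdot,t)\in V_h$ such that for every $j$ $$\int_{I_j}(u_h)_t v_h\,dx+A_j(u_h,v_h)+\sigma B_{h,j}(u_h,v_h)=\int_{I_j}f_s v_h\,dx,\qquad\forall v_h\in V_h,$$ where $$A_j(u_h,v_h)=\hat f_{j+1/2}(v_h)^-_{j+1/2}-\hat f_{j-1/2}(v_h)^+_{j-1/2}-\int_{I_j}f(u_h)(v_h)_x\,dx,$$ $\hat f_{j+1/2}=\hat f\big((u_h)^-_{j+1/2},(u_h)^+_{j+1/2}\big)$ is a monotone numerical flux, and $\sum_j B_{h,j}(u_h,v_h)=B_h(u_h,v_h)$. Then the numerical solution satisfies $$\frac12\frac{d}{dt}\|u_h(\cdot,t)\|_{L^2}^2+\sum_j\Theta_j+\sigma B_h(u_h,u_h)=(f_s,u_h),$$ where $$\Theta_j=\int_{(u_h)^-_{j+1/2}}^{(u_h)^+_{j+1/2}}\Big(f(u)-\hat f\big((u_h)^-_{j+1/2},(u_h)^+_{j+1/2}\big)\Big)\,du\ \ge 0.$$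
   Context: **Setting.** $\Omega=(a,b)$, $\delta>0$, $\Omega_\delta=[a-\delta,a]\cup[b,b+\delta]$, $\widetilde\Omega=\Omega\cup\Omega_\delta$. The kernel $\gamma_\delta$ is nonnegative, even, $s^2\gamma_\delta(s)\in L^1_{loc}(\mathbb{R})$, and normalized by $\int_{-\delta}^{\delta}s^2\gamma_\delta(s)\,ds=1$. $\mathcal{L}_\delta u(x)=-2\int_{x-\delta}^{x+\delta}(u(y)-u(x))\gamma_\delta(x-y)\,dy$. $E_s^+w(x)=w(x+s)-w(x)$; $(\cdot,\cdot)$ is the $L^2$ inner product; $w^\pm_{j+1/2}=w(x_{j+1/2}^\pm)$ are one-sided limits. A monotone flux is a function $\hat f(u^-,u^+)$ that is consistent ($\hat f(u,u)=f(u)$), Lipschitz continuous, nondecreasing in its first and nonincreasing in its second argument. **Mesh and space.** The mesh consists of intervals $I_j=(x_{j-1/2},x_{j+1/2})$, $j=-m+1,\dots,N+m$, with $x_{1/2}=a$, $x_{N+1/2}=b$, $x_{-m+1/2}\le a-\delta<x_{-m+3/2}$, $x_{N+m-1/2}<b+\delta\le x_{N+m+1/2}$; $h_j=x_{j+1/2}-x_{j-1/2}$, $h=\max_jh_j$, $\rho=\min_j h_j$, and $\nu h\le\rho$ for a fixed $\nu>0$. In the compactly supported case, $V_h=\{v\in L^2(\widetilde\Omega): v|_{I_j}\in\mathcal{P}_k(I_j),\ j=1,\dots,N,\ v|_{\Omega_\delta}=0\}$ ($\mathcal P_k$: polynomials of degree at most $k$), functions are extended by zero and sums over $j$ run over all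 mesh indices. In the periodic case, $V_h$ consists of piecewise polynomials of degree at most $k$ on $I_1,\dots,I_N$ extended $(b-a)$-periodically, the mesh is also extended periodically, and sums over $j$ run over $j=1,\dots,N$. Set $\hat h=\min\{\rho,\delta\}$, $I_{j,2}^s=(x_{j+1/2}-s,x_{j+1/2})$, $[\![w]\!]_{j+1/2}=w(x_{j+1/2}^+)-w(x_{j+1/2}^-)$. **Bilinear form.** Let $g_v(x,s)=E_s^+v(x)-[\![v]\!]_{j+1/2}$ if $x\in I_{j,2}^s$ and $s\in(0,\hat h)$, and $g_v(x,s)=E_s^+v(x)$ otherwise. Define $$E(u,v)=2\int_0^\delta\gamma_\delta(s)\sum_j\int_{I_j}g_u(x,s)g_v(x,s)\,dx\,ds,\qquad P(u,v)=\int_0^{\hat h}s^2\gamma_\delta(s)\,ds\ \sum_j[\![u]\!]_{j+1/2}[\![v]\!]_{j+1/2},$$ $$K(u,v)=2\sum_j[\![v]\!]_{j+1/2}\int_0^{\hat h}\gamma_\delta(s)\int_{I_{j,2}^s}g_u(x,s)\,dx\,ds,$$ and $B_h=E+J+\mu P$ with penalty parameter $\mu>0$, where $J=0$ (nBZ), $J(u,v)=K(u,v)+K(v,u)$ (nIP), or $J(u,v)=K(u,v)-K(v,u)$ (nNIPG). The $B_{h,j}$ are the elementwise contributions to $B_h$, i.e. $\sum_jB_{h,j}=B_h$. *)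

(* Defs.v *)
From HB Require Import structures.
From mathcomp Require Import all_boot all_order all_algebra.
From mathcomp Require Import all_classical all_reals all_analysis.
Set Implicit Arguments.
Unset Strict Implicit.
Unset Printing Implicit Defensive.
Import Order.TTheory GRing.Theory Num.Theory.
Import numFieldNormedType.Exports.
Local Open Scope classical_set_scope.
Local Open Scope ring_scope.

Notation Leb := (@lebesgue_measure _).

Definition nonlocal_kernel (R : realType) (delta : R) (gamma : R -> R) : Prop :=
  [/\ (forall s, 0 <= gamma s),
      (forall s, gamma (- s) = gamma s),
      locally_integrable setT (fun s => s ^+ 2 * gamma s) &
      \int[Leb]_(s in `[- delta, delta]) (s ^+ 2 * gamma s) = 1].

Definition monotone_flux (R : realType) (f : R -> R) (fhat : R -> R -> R) : Prop :=
  [/\ (forall u, fhat u u = f u),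
      lipschitz (fun p : R * R => fhat p.1 p.2),
      (forall w, {homo fhat ^~ w : u v / u <= v}) &
      (forall w, {homo fhat w : u v /~ u <= v})].

Inductive boundary := Periodic | Compact.

(* [node j] is x_{j+1/2}, so that I_j = (node (j - 1), node j); [nghost] is the
   number m of cells on each side of Omega, and is irrelevant in the periodic
   case, where [node] is the periodic extension of the mesh of Omega. *)
Record mesh (R : realType) := Mesh {
  bc : boundary;
  lft : R;
  rgt : R;
  delta : R;
  ncell : nat;
  nghost : nat;
  node : int -> R
}.

Section Mesh.
Context {R : realType}.
Implicit Types (M : mesh R) (j : int) (u v : R -> R).

Definition Omega M : set R := `]lft M, rgt M[.

Definition cell M j : set R := `]node M (j - 1), node M j[.

Definition size_cell M j : R := node M j - node M (j - 1).

(* 1, ..., N (periodic) or - m + 1, ..., N + m (compact support) *)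
Definition cells M : seq int :=
  match bc M with
  | Periodic => [seq i%:Z | i <- iota 1 (ncell M)]
  | Compact =>
      [seq i%:Z - (nghost M)%:Z | i <- iota 1 (ncell M + (nghost M).*2)]
  end.

Definition hmax M : R :=
  \big[Num.max/size_cell M 1]_(j <- cells M) size_cell M j.

Definition hmin M : R :=
  \big[Num.min/size_cell M 1]_(j <- cells M) size_cell M j.

Definition hhat M : R := Num.min (hmin M) (delta M).

Definition mesh_extension M : Prop :=
  match bc M with
  | Periodic =>
      forall j, node M (j + (ncell M)%:Z) = node M j + (rgt M - lft M)
  | Compact =>
      let N := (ncell M)%:Z in let m := (nghost M)%:Z in
      [/\ node M (- m) <= lft M - delta M < node M (- m + 1) &
          node M (N + m - 1) < rgt M + delta M <= node M (N + m)]
  end.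

Definition mesh_axioms (nu : R) M : Prop :=
  [/\ [/\ lft M < rgt M, 0 < delta M & (0 < ncell M)%N],
      (forall j, j \in cells M -> node M (j - 1) < node M j),
      node M 0 = lft M /\ node M (ncell M)%:Z = rgt M,
      mesh_extension M &
      0 < nu /\ nu * hmax M <= hmin M].

(* The space V_h. Elements are represented by functions on the whole line,
   already extended by zero or periodically; values at the nodes inside Omega
   are left free, as they do not affect any integral or one-sided limit. *)
Definition dg_space M (k : nat) v : Prop :=
  (forall j, 1 <= j <= (ncell M)%:Z ->
     exists2 p : {poly R}, (size p <= k.+1)%N &
       forall x, cell M j x -> v x = p.[x]) /\
  match bc M with
  | Periodic => forall x, v (x + (rgt M - lft M)) = v x
  | Compact => forall x, ~ Omega M x -> v x = 0
  end.

Definition l2dot M u v : R := \int[Leb]_(x in Omega M) (u x * v x).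

Definition l2norm M u : R := Num.sqrt (l2dot M u u).

Definition square_integrable M u : Prop :=
  measurable_fun (Omega M) u /\
  Leb.-integrable (Omega M) (fun x => (u x ^+ 2)%:E).

Definition trl M v j : R := lim (v x @[x --> (node M j)^'-]).

Definition trr M v j : R := lim (v x @[x --> (node M j)^'+]).

Definition jump M v j : R := trr M v j - trl M v j.

Definition I2 M j (s : R) : set R := `]node M j - s, node M j[.

(* For x in I_j, the only set I_{i,2}^s that can contain x, for s < hhat, is
   the one with i = j; hence g is indexed by the cell containing x. *)
Definition g M j v (x s : R) : R :=
  if (x \in I2 M j s) && (0 < s < hhat M) then v (x + s) - v x - jump M v j
  else v (x + s) - v x.

Definition Eform M (gamma : R -> R) u v : R :=
  2 * \int[Leb]_(s in `]0, delta M[)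
        (gamma s * \sum_(j <- cells M)
           \int[Leb]_(x in cell M j) (g M j u x s * g M j v x s)).

Definition Pform M (gamma : R -> R) u v : R :=
  (\int[Leb]_(s in `]0, hhat M[) (s ^+ 2 * gamma s)) *
  \sum_(j <- cells M) jump M u j * jump M v j.

Definition Kform M (gamma : R -> R) u v : R :=
  2 * \sum_(j <- cells M) jump M v j *
        \int[Leb]_(s in `]0, hhat M[)
          (gamma s * \int[Leb]_(x in I2 M j s) g M j u x s).

Inductive scheme := nBZ | nIP | nNIPG.

Definition Jform M (gamma : R -> R) (sch : scheme) u v : R :=
  match sch with
  | nBZ => 0
  | nIP => Kform M gamma u v + Kform M gamma v u
  | nNIPG => Kform M gamma u v - Kform M gamma v u
  end.

Definition Bform M (gamma : R -> R) (sch : scheme) (mu : R) u v : R :=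
  Eform M gamma u v + Jform M gamma sch u v + mu * Pform M gamma u v.

Definition elementwise_split M (k : nat) (B : (R -> R) -> (R -> R) -> R)
    (Bj : int -> (R -> R) -> (R -> R) -> R) : Prop :=
  forall u v, dg_space M k u -> dg_space M k v ->
    \sum_(j <- cells M) Bj j u v = B u v.

Definition flux_at M (fhat : R -> R -> R) u j : R :=
  fhat (trl M u j) (trr M u j).

Definition Aform M (f : R -> R) (fhat : R -> R -> R) j u v : R :=
  flux_at M fhat u j * trl M v j
  - flux_at M fhat u (j - 1) * trr M v (j - 1)
  - \int[Leb]_(x in cell M j) (f (u x) * derive1 v x).

Definition oriented_integral (c d : R) (F : R -> R) : R :=
  if c <= d then \int[Leb]_(x in `[c, d]) F x
  else - \int[Leb]_(x in `[d, c]) F x.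

Definition Theta M (f : R -> R) (fhat : R -> R -> R) u j : R :=
  oriented_integral (trl M u j) (trr M u j)
    (fun w => f w - flux_at M fhat u j).

(* The time derivative is taken pointwise inside the cells; since u t is there
   a polynomial of degree at most k, this amounts to differentiability of its
   coefficients. The unknown is written u t x. *)
Definition semidiscrete_solution M (k : nat) (f : R -> R) (fhat : R -> R -> R)
    (sigma : R) (Bj : int -> (R -> R) -> (R -> R) -> R)
    (fs u : R -> R -> R) : Prop :=
  forall t : R, 0 < t ->
  [/\ dg_space M k (u t),
      (forall j x, j \in cells M -> cell M j x ->
         derivable (fun tau => u tau x) t 1) &
      forall j v, j \in cells M -> dg_space M k v ->
        \int[Leb]_(x in cell M j) (derive1 (fun tau => u tau x) t * v x)
        + Aform M f fhat j (u t) v + sigma * Bj j (u t) v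
        = \int[Leb]_(x in cell M j) (fs t x * v x)].

End Mesh.

(* Main.v *)
(** Test the scheme with [u t] itself and sum over the cells. With a primitive
    [F] of [f], the convective term of cell [j] is the difference of
    [fhat * u - F u] at the left trace on node [j] and at the right trace on
    node [j - 1]. After a shift of the index, whose end terms agree by
    periodicity or because [u] vanishes outside Omega, the two traces at each
    node recombine into [Theta], whose sign is the monotonicity of [fhat].
    The time derivative is exchanged with the integral over a cell by writing
    [u t] through its values at finitely many fixed points of that cell. *)

Require Import Defs.
From HB Require Import structures.
From mathcomp Require Import all_boot all_order all_algebra.
From mathcomp Require Import all_classical all_reals all_analysis.
From mathcomp Require Import measurable_realfun qpoly ring lra zify.
Set Implicit Arguments.
Unset Strict Implicit.
Unset Printing Implicit Defensive.
Import Order.TTheory GRing.Theory Num.Theory.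
Import numFieldNormedType.Exports.
Local Open Scope classical_set_scope.
Local Open Scope ring_scope.

(** * Integrals, primitives and one-sided limits on the real line *)

Section RealAnalysis.
Context {R : realType}.
Implicit Types (f h : R -> R) (F : R -> R) (p q : {poly R}) (a b t : R).

Lemma continuous_integrable_cc f a b : continuous f ->
  Leb.-integrable `[a, b] (EFin \o f).
Proof.
move=> cf; apply: continuous_compact_integrable; first exact: segment_compact.
exact: continuous_subspaceT.
Qed.

Lemma continuous_integrable_oo f a b : continuous f ->
  Leb.-integrable `]a, b[ (EFin \o f).
Proof.
move=> /(@continuous_integrable_cc f a b); apply: integrableS => //.
exact: subset_itv_oo_cc.
Qed.

Lemma Rintegral_oo_cc f a b : continuous f ->
  \int[Leb]_(x in `]a, b[) f x = \int[Leb]_(x in `[a, b]) f x.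
Proof.
move=> cf; rewrite Rintegral_itv_bndo_bndc; last exact: continuous_integrable_oo.
rewrite Rintegral_itv_obnd_cbnd//.
apply: integrableS (@continuous_integrable_cc f a b cf) => //.
exact: subset_itv_oc_cc.
Qed.

Lemma FTC2_Rintegral f F a b : a <= b -> continuous f ->
  (forall x : R, is_derive x 1 F (f x)) ->
  \int[Leb]_(x in `[a, b]) f x = F b - F a.
Proof.
move=> + cf dF; rewrite le_eqVlt => /predU1P[->|ab].
  by rewrite set_itv1 Rintegral_set1 subrr.
have cF : continuous F.
  by move=> x; apply/differentiable_continuous/derivable1_diffP.
rewrite /Rintegral (@continuous_FTC2 _ f F)//=.
- exact: continuous_subspaceT.
- split => [x _//||]; [exact/cvg_at_right_filter/cF|exact/cvg_at_left_filter/cF].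
- by move=> x _; rewrite derive1E; case: (dF x).
Qed.

(** An integral from a fixed base point is a primitive only to the right of that point. The base
    point therefore moves left with [|x|], and subtracting the value at 0 cancels the constant that
    such a move introduces. *)
Lemma continuous_primitive f : continuous f ->
  exists F, forall x : R, is_derive x 1 F (f x).
Proof.
move=> cf; pose G c x := \int[Leb]_(y in `[c, x]) f y.
have GE c c' x : c' <= c -> c <= x -> G c x = G c' x - G c' c.
  move=> c'c cx; rewrite /G Rintegral_itvB ?bnd_simp//; last first.
    exact: continuous_integrable_cc.
  rewrite Rintegral_itv_obnd_cbnd//.
  apply: integrableS (@continuous_integrable_cc f c x cf) => //.
  exact: subset_itv_oc_cc.
have GF (c x : R) : c < x -> is_derive x 1 (G c) (f x).
  move=> cx; have [] := @continuous_FTC1_closed _ f c x (x + 1) _ _ cx (cf x).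
  - by rewrite ltrDl.
  - exact: continuous_integrable_cc.
  - by rewrite derive1E => ? <-; exact: derivableP.
pose F x := G (- (`|x| + 1)) x - G (- (`|x| + 1)) 0.
(* For [y] within 1 of [x] we have [|y| <= |x| + 1], so this [c] lies to the left of the base point
   that [F] uses at [y], and one base point serves the whole neighbourhood. *)
exists F => x; pose c := - (`|x| + 2).
have /near_eq_is_derive : \forall y \near x, G c y - G c 0 = F y.
  apply: filterS (nbhsx_ballx x 1 ltr01) => y; rewrite /ball/= distrC /F => yx.
  have /andP[yx1 yx2] : - 1 < y - x < 1 by rewrite -ltr_norml.
  have := ler_norm y; have := ler_norm (- y); rewrite normrN => y1 y2.
  have := ler_norm x; have := ler_norm (- x); rewrite normrN => x1 x2.
  have xy : `|y| <= `|x| + 1.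
    rewrite ler_norml; lra.
  rewrite (GE (- (`|y| + 1)) c y) ?(GE (- (`|y| + 1)) c 0) /c; lra.
apply; rewrite -[f x]subr0; apply: is_deriveB; apply: GF.
by rewrite /c; have := ler_norm (- x); rewrite normrN; lra.
Qed.

Lemma is_derive_bigsum (I : eqType) (s : seq I) (f : I -> R -> R) (df : I -> R) t :
  (forall i, i \in s -> is_derive t 1 (f i) (df i)) ->
  is_derive t 1 (fun x => \sum_(i <- s) f i x) (\sum_(i <- s) df i).
Proof.
elim: s => [|i s ih] H.
  rewrite big_nil; under eq_fun do rewrite big_nil; exact: is_derive_cst.
rewrite big_cons; under eq_fun do rewrite big_cons.
apply: is_deriveD; first by apply: H; rewrite mem_head.
by apply: ih => j js; apply: H; rewrite in_cons js orbT.
Qed.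

Lemma trace_left (v : R -> R) p a b : a < b ->
  (forall x, `]a, b[%classic x -> v x = p.[x]) -> lim (v x @[x --> b^'-]) = p.[b].
Proof.
move=> ab vp; apply/cvg_lim => //.
apply: cvg_trans (cvg_at_left_filter (@continuous_horner _ p b)).
apply: near_eq_cvg; near=> x; apply/esym/vp; rewrite /= in_itv/=; apply/andP; split.
  by near: x; exact: nbhs_left_gt.
by near: x; exact: nbhs_left_lt.
Unshelve. all: by end_near. Qed.

Lemma trace_right (v : R -> R) p a b : a < b ->
  (forall x, `]a, b[%classic x -> v x = p.[x]) -> lim (v x @[x --> a^'+]) = p.[a].
Proof.
move=> ab vp; apply/cvg_lim => //.
apply: cvg_trans (cvg_at_right_filter (@continuous_horner _ p a)).
apply: near_eq_cvg; near=> x; apply/esym/vp; rewrite /= in_itv/=; apply/andP; split.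
  by near: x; exact: nbhs_right_gt.
by near: x; exact: nbhs_right_lt.
Unshelve. all: by end_near. Qed.

End RealAnalysis.

(** * Cell-by-cell integration and differentiation of cell integrals in time *)

Lemma integrable_setU (d : measure_display) (T : measurableType d) (R : realType)
    (mu : {measure set T -> \bar R}) (A B : set T) (h : T -> \bar R) :
  measurable A -> measurable B -> [disjoint A & B] ->
  mu.-integrable A h -> mu.-integrable B h -> mu.-integrable (A `|` B) h.
Proof.
move=> mA mB AB iA iB; have mU g : mu.-integrable A g -> mu.-integrable B g ->
    measurable_fun (A `|` B) g.
  by move=> /measurable_int gA /measurable_int gB; apply/measurable_funU.
apply/integrableP; split; first exact: mU.
rewrite ge0_integral_setU//; last by apply: mU; exact: integrable_abse.
by case/integrableP: iA => _ ?; case/integrableP: iB => _ ?; exact: lte_add_pinfty.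
Qed.

(** Integrability and additivity are proved together: the inductive step needs the tail to be
    integrable, and double sums reuse the first component for the inner sum. *)
Lemma Rintegral_bigsum (d : measure_display) (T : measurableType d) (R : realType)
    (mu : {measure set T -> \bar R}) (I : Type) (s : seq I) (A : set T)
    (h : I -> T -> R) :
  measurable A -> (forall i, mu.-integrable A (EFin \o h i)) ->
  mu.-integrable A (EFin \o (fun x => \sum_(i <- s) h i x)) /\
  \int[mu]_(x in A) (\sum_(i <- s) h i x) = \sum_(i <- s) \int[mu]_(x in A) h i x.
Proof.
move=> mA ih; elim: s => [|i s [iS eS]].
  rewrite (_ : (fun x => _) = cst 0); last by apply/funext => x; rewrite big_nil.
  by rewrite big_nil Rintegral_cst// mul0r; split => //; exact: integrable0.
rewrite (_ : (fun x => _) = h i \+ (fun x => \sum_(j <- s) h j x)); last first.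
  by apply/funext => x; rewrite big_cons.
by rewrite big_cons -eS RintegralD//; split => //; exact: (integrableD mA (ih i) iS).
Qed.

Section CellIntegrals.
Context {R : realType}.
Implicit Types (f h : R -> R) (F : R -> R) (p q : {poly R}) (a b t : R).

(** Half-open intervals concatenate without overlap, and each differs from its open cell by a single
    node, a null set on which [h] may take any value. *)
Lemma Rintegral_co_sum (x : nat -> R) n h :
  (forall i, (i < n)%N -> x i < x i.+1) ->
  (forall i, (i < n)%N -> Leb.-integrable `]x i, x i.+1[ (EFin \o h)) ->
  Leb.-integrable `[x 0%N, x n[ (EFin \o h) /\
  \int[Leb]_(y in `[x 0%N, x n[) h y =
    \sum_(0 <= i < n) \int[Leb]_(y in `]x i, x i.+1[) h y.
Proof.
elim: n => [_ _|n ih xlt ihx].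
  by rewrite set_itvco0 big_geq// Rintegral_set0; split => //; exact: integrable_set0.
have xle0 : x 0%N <= x n.
  elim: n xlt {ih ihx} => // n ih xlt.
  by rewrite (le_trans (ih _)) ?ltW ?xlt// => i ltin; apply: xlt; exact: ltnW.
have [| |iS eS] := ih; [by move=> i /leqW /xlt|by move=> i /leqW /ihx|].
have iN : Leb.-integrable `[x n, x n.+1[ (EFin \o h).
  rewrite -(setU1itv false) ?bnd_simp ?xlt//; apply: integrable_setU => //.
  - apply/disj_setPS => y [/= ->]; by rewrite in_itv/= ltxx.
  - apply/integrableP; split; first exact: measurable_fun_set1.
    by rewrite integral_set1 ltry.
  - exact: ihx.
rewrite big_nat_recr//= -eS (@itv_bndbnd_setU _ _ _ (BLeft (x n))) ?bnd_simp//;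
  last exact/ltW/xlt.
have dis : [disjoint `[x 0%N, x n[ & `[x n, x n.+1[]%classic.
  by apply/disj_setPS => y []; rewrite /= !in_itv/= => /andP[_ yx] /andP[]; rewrite leNgt yx.
have iU : Leb.-integrable (`[x 0%N, x n[ `|` `[x n, x n.+1[) (EFin \o h).
  exact: integrable_setU.
split=> //; rewrite Rintegral_setU//; congr (_ + _).
by rewrite -Rintegral_itv_obnd_cbnd//; exact: ihx.
Qed.

(* [|h p| <= h^2 + p^2] *)
Lemma integrable_mul_poly h p a b : measurable_fun `]a, b[ h ->
  Leb.-integrable `]a, b[ (fun x => (h x ^+ 2)%:E) ->
  Leb.-integrable `]a, b[ (fun x => (h x * p.[x])%:E).
Proof.
move=> mh ih2.
have ip : Leb.-integrable `]a, b[ (fun x => (p.[x] ^+ 2)%:E).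
  apply: (@continuous_integrable_oo _ (fun x => p.[x] ^+ 2)).
  move=> x; apply: continuousM; exact: continuous_horner.
apply: le_integrable (integrableD _ ih2 ip) => //.
  apply/measurable_EFinP; apply: measurable_funM => //.
  apply: open_continuous_measurable_fun => // x _; exact: continuous_horner.
move=> x _ /=; rewrite lee_fin normrM.
rewrite [leRHS]ger0_norm ?addr_ge0 ?sqr_ge0//.
rewrite -(real_normK (num_real (h x))) -(real_normK (num_real p.[x])).
have := sqr_ge0 (`|h x| - `|p.[x]|); have := sqr_ge0 (`|h x| + `|p.[x]|); nra.
Qed.

(** The nodes and the basis do not depend on [p], so a time-dependent polynomial has its nodal
    values as its only time-dependent coefficients. *)
Lemma lagrange_itv a b n : a < b -> exists (x : nat -> R) (l : 'I_n.+1 -> {poly R}),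
  (forall i, `]a, b[%classic (x i)) /\
  (forall p, (size p <= n.+1)%N -> p = \sum_(i < n.+1) p.[x i] *: l i).
Proof.
(* The denominator starts at 2, so that even the node [x 0], the midpoint, stays away from [b]. *)
move=> ab; pose x (i : nat) := a + (b - a) / (i.+2)%:R.
have x_inj : injective x.
  move=> i j /addrI /(mulfI _); rewrite subr_eq0 gt_eqF// => /(_ isT)/invr_inj/eqP.
  by rewrite eqr_nat => /eqP[].
exists x, (tnth (n.+1.-lagrange x)); split => [i|p sp].
  rewrite /= in_itv/= /x ltrDl divr_gt0 ?subr_gt0//= -ltrBrDl gtr_pMr ?subr_gt0//.
  by rewrite invf_lt1 ?ltr0n// ltr1n.
rewrite {1}(lagrange_gen _ x_inj sp)//.
by apply: eq_bigr => i _; rewrite mul_polyC.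
Qed.

(** In the Lagrange basis the integral is a quadratic form in the nodal values of [w s], with a
    constant Gram matrix [G]; the product rule then applies to finite sums. *)
Lemma is_derive_integral_poly_sqr (w : R -> R -> R) a b t n : a < b ->
  (\forall s \near t, exists2 p : {poly R}, (size p <= n)%N &
     forall x : R, `]a, b[%classic x -> w s x = p.[x]) ->
  (forall x : R, `]a, b[%classic x -> derivable (w ^~ x) t 1) ->
  is_derive t 1 (fun s => \int[Leb]_(x in `]a, b[) (w s x * w s x))
    (2 * \int[Leb]_(x in `]a, b[) (derive1 (w ^~ x) t * w t x)).
Proof.
move=> ab wp dw.
have [x [l [xab lE]]] := lagrange_itv n ab.
pose G i j := \int[Leb]_(y in `]a, b[) ((l i).[y] * (l j).[y]).
have wE : \forall s \near t, forall y : R, `]a, b[%classic y ->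
    w s y = \sum_(i < n.+1) w s (x i) * (l i).[y].
  apply: filterS wp => s [p sp ps] y yab.
  (* There is one node more than the size bound [n] asks for, which also covers [n = 0]. *)
  rewrite ps// {1}(lE p (leqW sp)) horner_sum; apply: eq_bigr => i _.
  by rewrite hornerZ ps.
(* Two coefficient families are kept apart: the square uses [c = d], the derivative pairs the nodal
   derivatives with the nodal values. *)
have IE (c d : 'I_n.+1 -> R) : \int[Leb]_(y in `]a, b[)
    ((\sum_i c i * (l i).[y]) * (\sum_i d i * (l i).[y])) =
    \sum_i \sum_j c i * d j * G i j.
  under eq_Rintegral => y _ do rewrite big_distrlr.
  have iG i j : Leb.-integrable `]a, b[ (EFin \o (fun y => (l i).[y] * (l j).[y])).
    apply: continuous_integrable_oo => y.
    by apply: continuousM; exact: continuous_horner.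
  have iH i j : Leb.-integrable `]a, b[
      (EFin \o (fun y => c i * (l i).[y] * (d j * (l j).[y]))).
    apply: eq_integrable (integrableZl _ (c i * d j) (iG i j)) => // y _ /=.
    by rewrite -EFinM; congr (_%:E); ring.
  have iS i := Rintegral_bigsum (mu := Leb) (index_enum 'I_n.+1) (@measurable_itv _ `]a, b[) (iH i).
  have [_ ->] := Rintegral_bigsum (mu := Leb) (index_enum 'I_n.+1) (@measurable_itv _ `]a, b[)
    (fun i => (iS i).1).
  apply: eq_bigr => i _; rewrite (iS i).2.
  apply: eq_bigr => j _; rewrite -RintegralZl//.
  by apply: eq_Rintegral => y _; ring.
have dwE y : `]a, b[%classic y ->
    derive1 (w ^~ y) t = \sum_(i < n.+1) derive1 (w ^~ (x i)) t * (l i).[y].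
  move=> yab; have [_ <-] : is_derive t 1 (fun s => \sum_(i < n.+1) w s (x i) * (l i).[y])
     (\sum_(i < n.+1) derive1 (w ^~ (x i)) t * (l i).[y]).
    apply: is_derive_bigsum => i _; rewrite derive1E mulrC.
    apply: is_derive_eq; first by apply: is_deriveM; exact/derivableP/dw.
    by rewrite scaler0 add0r.
  by rewrite derive1E; apply: near_eq_derive; apply: filterS wE => s ->.
rewrite (_ : \int[Leb]_(_ in _) _ = \sum_(i < n.+1) \sum_(j < n.+1)
    derive1 (w ^~ (x i)) t * w t (x j) * G i j); last first.
  rewrite -IE; apply: eq_Rintegral => y; rewrite inE => yab.
  by rewrite dwE// (nbhs_singleton wE).
have : is_derive t 1 (fun s => \sum_(i < n.+1) \sum_(j < n.+1) w s (x i) * w s (x j) * G i j)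
  (2 * \sum_(i < n.+1) \sum_(j < n.+1) derive1 (w ^~ (x i)) t * w t (x j) * G i j).
  apply: is_derive_eq.
    apply: is_derive_bigsum => i _; apply: is_derive_bigsum => j _.
    apply: is_deriveM; apply: is_deriveM; exact/derivableP/dw.
  have Gsym i j : G i j = G j i by apply: eq_Rintegral => y _; rewrite mulrC.
  (* The product rule yields two double sums; exchanging the indices in one and using the symmetry
     of [G] identifies them, hence the factor 2. *)
  rewrite mulr2n mulrDl mul1r [X in _ = _ + X]exchange_big -big_split.
  apply: eq_bigr => i _ /=.
  rewrite -big_split; apply: eq_bigr => j _ /=.
  by rewrite !derive1E (Gsym j i) /GRing.scale/=; ring.
apply: near_eq_is_derive; apply: filterS wE => s ws.
by rewrite -IE; apply: eq_Rintegral => y; rewrite inE => yab; rewrite ws.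
Qed.

End CellIntegrals.

(** * Continuity and entropy sign of a monotone flux *)

Section Flux.
Context {R : realType}.
Implicit Types (f : R -> R) (fhat : R -> R -> R) (F : R -> R).

(** By consistency [f] is the restriction of the Lipschitz function [fhat] to the diagonal. *)
Lemma monotone_flux_continuous f fhat : monotone_flux f fhat -> continuous f.
Proof.
move=> [fhatE [c [_ lip]] _ _] x.
(* [lipschitz] provides a threshold [c] above which every constant works; [|c| + 1] exceeds it and
   is positive. *)
have L y : `|f x - f y| <= (`|c| + 1) * `|x - y|.
  have := lip (`|c| + 1) _ ((x, x), (y, y)) (conj I I) => /=.
  rewrite !fhatE => /(_ _)/le_trans; apply; first by rewrite (le_lt_trans (ler_norm c)) ?ltrDl.
  by rewrite ler_pM2l ?ltr_wpDl// /Num.norm/= ge_max !lexx.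
apply/cvgrPdist_lt => e e0; near=> y.
rewrite (le_lt_trans (L y))// -ltr_pdivlMl ?ltr_wpDl//.
near: y; apply: (nbhsx_ballx x).
by rewrite mulr_gt0 ?invr_gt0 ?ltr_wpDl.
Unshelve. all: by end_near. Qed.

(** If [c <= w <= d], then [fhat c d <= fhat c w <= fhat w w = f w]. If [d <= w <= c], both
    inequalities reverse, and the orientation of the integral restores the sign. *)
Lemma monotone_flux_entropy f fhat c d : monotone_flux f fhat ->
  0 <= oriented_integral c d (fun w => f w - fhat c d).
Proof.
move=> fhat_flux; have cf := monotone_flux_continuous fhat_flux.
case: fhat_flux => fhatE _ incr decr; rewrite /oriented_integral; case: ifPn => [cd|].
  apply: Rintegral_ge0 => w; rewrite /= in_itv/= => /andP[cw wd].
  by rewrite subr_ge0 -fhatE (le_trans (decr _ _ _ wd))// incr.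
move=> _; rewrite -mulN1r -RintegralZl//; last first.
  apply: (@continuous_integrable_cc _ (fun w => f w - fhat c d)) => x.
  by apply: continuousB; [exact: cf|exact: cst_continuous].
apply: Rintegral_ge0 => w; rewrite /= in_itv/= => /andP[dw wc].
by rewrite mulN1r oppr_ge0 subr_le0 -fhatE (le_trans (incr _ _ _ wc))// decr.
Qed.

(** Turns [Theta] into an algebraic expression in the two traces, whichever of them is larger. *)
Lemma oriented_integral_sub_cst f F c d r : continuous f ->
  (forall x : R, is_derive x 1 F (f x)) ->
  oriented_integral c d (fun w => f w - r) = F d - F c - r * (d - c).
Proof.
move=> cf dF; have cfr : continuous (fun w => f w - r).
  by move=> x; apply: continuousB; [exact: cf|exact: cst_continuous].
have dFr (x : R) : is_derive x 1 (fun y : R => F y - r * y) (f x - r).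
  have rid : is_derive x 1 (fun y : R => r * y) r.
    have := @is_deriveM R R (cst r) id x 1 0 1 (is_derive_cst _ _ _) (is_derive_id _ _).
    by rewrite scaler0 addr0 /GRing.scale/= mulr1.
  exact: is_deriveB.
rewrite /oriented_integral; case: ifPn => [cd|].
  by rewrite (FTC2_Rintegral cd cfr dFr); ring.
by rewrite -ltNge => /ltW dc; rewrite (FTC2_Rintegral dc cfr dFr); ring.
Qed.

End Flux.

(** * Sums over cells, and traces at the ends of the mesh *)

Section MeshTheory.
Context {R : realType}.
Implicit Types (M : mesh R) (j : int) (v : R -> R).

(* [nghost M] is meaningless in the periodic case; [ghosts M] lets both kinds of
   mesh be indexed by [1 - ghosts M, ..., ncell M + ghosts M]. *)
Definition ghosts M : nat := if bc M is Compact then nghost M else 0%N.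

Lemma cellsE M : cells M =
  [seq i%:Z - (ghosts M)%:Z | i <- iota 1 (ncell M + (ghosts M).*2)].
Proof.
rewrite /cells /ghosts; case: (bc M) => //; rewrite addn0.
by apply: eq_map => i; rewrite subr0.
Qed.

Lemma mem_cells M j : (j \in cells M) =
  (- (ghosts M)%:Z < j <= (ncell M)%:Z + (ghosts M)%:Z).
Proof.
rewrite cellsE; apply/mapP/idP => [[i]|].
  by rewrite mem_iota => ? ->; lia.
move=> ?; exists `|(j + (ghosts M)%:Z)%R|%N; last by lia.
rewrite mem_iota; lia.
Qed.

Lemma big_cells M (G : int -> R) : \sum_(j <- cells M) G j =
  \sum_(0 <= i < ncell M + (ghosts M).*2) G (i%:Z + 1 - (ghosts M)%:Z).
Proof.
rewrite cellsE big_map -[1%N]addn0 iotaDl big_map /index_iota subn0.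
by apply: eq_bigr => i _; congr (G _); lia.
Qed.

Lemma big_cells_shift M (G : int -> R) :
  G (- (ghosts M)%:Z) = G ((ncell M)%:Z + (ghosts M)%:Z) ->
  \sum_(j <- cells M) G (j - 1) = \sum_(j <- cells M) G j.
Proof.
move=> Gper; apply/eqP; rewrite eq_sym -subr_eq0 -sumrB big_cells.
(* [H i] is [G] at the left node of the cell numbered [i] from 0, so the difference of the sums
   telescopes to the two end terms. *)
pose H (i : nat) := G (i%:Z - (ghosts M)%:Z).
rewrite (eq_bigr (fun i => H i.+1 - H i)) => [|i _]; last first.
  by congr (G _ - G _); lia.
rewrite telescope_sumr// /H sub0r Gper subr_eq0; apply/eqP; congr G; lia.
Qed.

(** The range is cut into left ghost cells, cells of Omega and right ghost cells; the outer blocks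
    vanish, and are empty in the periodic case. *)
Lemma big_cells_Omega M (G : int -> R) :
  (forall j, j \in cells M -> ~~ (1 <= j <= (ncell M)%:Z) -> G j = 0) ->
  \sum_(j <- cells M) G j = \sum_(0 <= i < ncell M) G (i.+1)%:Z.
Proof.
move=> G0; rewrite big_cells; set g := ghosts M; set N := ncell M.
have G0' i : (i < N + g.*2)%N -> ~~ (g <= i < N + g)%N -> G (i%:Z + 1 - g%:Z) = 0.
  by move=> ? ?; apply: G0; rewrite ?mem_cells -/g -/N; lia.
have outer m n : (forall i, (m <= i < n)%N -> (i < N + g.*2)%N && ~~ (g <= i < N + g)%N) ->
    \sum_(m <= i < n) G (i%:Z + 1 - g%:Z) = 0.
  by move=> mn; rewrite big_nat big1// => i /mn/andP[]; exact: G0'.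
rewrite (big_cat_nat (n := g)) ?leq0n//=; last by lia.
rewrite (big_cat_nat (n := N + g) (m := g))/=; [|lia..].
rewrite outer ?[X in _ + (_ + X)]outer ?add0r ?addr0 => [|i|i]; [|lia..].
by rewrite -{1}[g]add0n big_addn addnK; apply: eq_bigr => i _; congr G; lia.
Qed.

Section ValidMesh.
Context (M : mesh R) (nu : R) (M_mesh : mesh_axioms nu M).

(** The bounds keep every cell between the two nodes in [cells M], where the mesh axioms order
    consecutive nodes. *)
Lemma node_le i j : - (ghosts M)%:Z <= i -> i <= j ->
  j <= (ncell M)%:Z + (ghosts M)%:Z -> node M i <= node M j.
Proof.
case: M_mesh => _ node_lt _ _ _ gi ij.
have -> : j = i + `|(j - i)%R|%N%:Z by lia.
elim: `|(j - i)%R|%N => [|n ih] jN; first by rewrite addr0.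
apply: le_trans (ih _) _; first lia.
have -> : i + n%:Z = i + n.+1%:Z - 1 by lia.
by apply/ltW/node_lt; rewrite mem_cells; lia.
Qed.

Lemma cell_ghost j x : j \in cells M -> ~~ (1 <= j <= (ncell M)%:Z) ->
  cell M j x -> ~ Omega M x.
Proof.
rewrite mem_cells => jM jN; rewrite /cell /Omega /= !in_itv/= => /andP[x1 x2] /andP[x3 x4].
case: M_mesh => _ _ [n0 nN] _ _.
have [j0|j0] := leP j 0.
  have : node M j <= lft M by rewrite -n0 node_le; lia.
  by move=> /(lt_le_trans x2)/(lt_trans x3); rewrite ltxx.
have : rgt M <= node M (j - 1) by rewrite -nN node_le; lia.
by move=> /(lt_le_trans x4)/lt_trans/(_ x1); rewrite ltxx.
Qed.

Lemma dg_space_ghost k v j x : dg_space M k v -> j \in cells M ->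
  ~~ (1 <= j <= (ncell M)%:Z) -> cell M j x -> v x = 0.
Proof.
move=> [_ vb] jM jN xj; have := cell_ghost jM jN xj; move: jM vb.
rewrite mem_cells /ghosts; case: (bc M) => [|_ vb]; last exact: vb.
by move=> jM; exfalso; move: jM jN; lia.
Qed.

(** Ghost cells carry the zero polynomial, so later arguments treat all cells alike. *)
Lemma dg_space_cell k v j : dg_space M k v -> j \in cells M ->
  exists2 p : {poly R}, (size p <= k.+1)%N & forall x, cell M j x -> v x = p.[x].
Proof.
move=> vk jM; have [jN|jN] := boolP (1 <= j <= (ncell M)%:Z); first exact: vk.1.
exists 0 => [|x xj]; first by rewrite size_poly0.
by rewrite horner0 (dg_space_ghost vk jM jN xj).
Qed.

Lemma trlE v (p : {poly R}) j : node M (j - 1) < node M j ->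
  (forall x, cell M j x -> v x = p.[x]) -> trl M v j = p.[node M j].
Proof. by move=> lt vp; exact: trace_left lt vp. Qed.

Lemma trrE v (p : {poly R}) j : node M (j - 1) < node M j ->
  (forall x, cell M j x -> v x = p.[x]) -> trr M v (j - 1) = p.[node M (j - 1)].
Proof. by move=> lt vp; exact: trace_right lt vp. Qed.

(* In the compact case the left trace at node [- nghost M] lies outside all cells;
   it is multiplied by the vanishing right trace. *)
Lemma trace_wrap k v : dg_space M k v ->
  match bc M with
  | Periodic => trl M v 0 = trl M v (ncell M)%:Z /\ trr M v 0 = trr M v (ncell M)%:Z
  | Compact => trr M v (- (nghost M)%:Z) = 0 /\
               trr M v ((ncell M)%:Z + (nghost M)%:Z) = 0
  end.
Proof.
move=> vk; case: M_mesh => [[lr d0 N0] node_lt [n0 nN] ext _].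
have cellM j : 1 <= j <= (ncell M)%:Z -> j \in cells M by rewrite mem_cells; lia.
case: vk (vk) => _; rewrite /mesh_extension in ext.
case: (bc M) ext => [ext vper|[/andP[m1 m2] /andP[m3 m4]] v0] vk.
- have c1 : 1 \in cells M by apply: cellM; lia.
  have cN : (ncell M)%:Z \in cells M by apply: cellM; lia.
  split.
    have [p _ vp] := dg_space_cell vk cN.
    rewrite (trlE (node_lt _ cN) vp) /trl.
    (* The cell ending at node 0 is the last cell of Omega moved left by one period; there [v] is
       [p] composed with the shift. *)
    have e1 : node M (-1) = node M ((ncell M)%:Z - 1) - (rgt M - lft M).
      by have := ext (-1); rewrite addrC => ->; rewrite addrK.
    rewrite (@trace_left _ v (p \Po ('X + (rgt M - lft M)%:P)) (node M (-1))).
    + by rewrite horner_comp !(hornerD, hornerX, hornerC) n0 nN; congr (_.[_]); ring.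
    + by rewrite e1 n0; have := node_lt _ cN; rewrite nN; lra.
    move=> x; rewrite /= in_itv/= => /andP[x1 x2].
    rewrite -vper vp ?horner_comp ?(hornerD, hornerN, hornerX, hornerC)// /cell /= in_itv/= nN.
    by move: x1 x2; rewrite e1 n0 => x1 x2; apply/andP; split; lra.
  have [p _ vp] := dg_space_cell vk c1.
  have := trrE (node_lt _ c1) vp; rewrite subrr => ->; rewrite /trr.
  (* Symmetrically, the cell starting at the last node of Omega is the first one moved right by one
     period. *)
  have e1 : node M ((ncell M)%:Z + 1) = node M 1 + (rgt M - lft M).
    by rewrite addrC ext.
  have := node_lt _ c1; rewrite subrr n0 => lt1.
  rewrite (@trace_right _ v (p \Po ('X - (rgt M - lft M)%:P)) _ (node M ((ncell M)%:Z + 1))).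
  + by rewrite horner_comp !(hornerD, hornerN, hornerX, hornerC) nN; congr (_.[_]); ring.
  + by rewrite e1 nN; lra.
  move=> x; rewrite /= in_itv/= nN e1 => /andP[x1 x2].
  have -> : v x = v (x - (rgt M - lft M)) by rewrite -[in LHS](subrK (rgt M - lft M) x) vper.
  rewrite vp ?horner_comp ?(hornerD, hornerN, hornerX, hornerC)// /cell /= in_itv/= subrr n0.
  by apply/andP; split; lra.
split.
  (* As [delta M > 0], the first node lies strictly left of Omega and [v] vanishes in between. At
     the last node [v] vanishes on the whole right side, so an interval of length 1 will do. *)
  rewrite /trr (@trace_right _ v 0 _ (lft M)) ?horner0//; first by lra.
  by move=> x; rewrite /= in_itv/= horner0 => /andP[x1 x2]; apply: v0; rewrite /Omega /= in_itv/=; lra.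
rewrite /trr (@trace_right _ v 0 _ (node M ((ncell M)%:Z + (nghost M)%:Z) + 1)) ?horner0 ?ltrDl//.
move=> x; rewrite /= in_itv/= horner0 => /andP[x1 x2]; apply: v0; rewrite /Omega /= in_itv/=; lra.
Qed.

End ValidMesh.
End MeshTheory.

(** * The terms of the scheme tested with the solution itself *)

Section EnergyIdentity.
Context {R : realType} (M : mesh R) (nu : R) (M_mesh : mesh_axioms nu M).
Implicit Types (f F v h : R -> R) (fhat : R -> R -> R) (j : int) (k : nat).

Lemma cell_lt j : j \in cells M -> node M (j - 1) < node M j.
Proof. by case: M_mesh => _ + _ _ _; exact. Qed.

(** On the cell [v] is a polynomial [p], and [f(p) p'] is the derivative of [F \o p], so the volume
    integral reduces to boundary traces. *)
Lemma Aform_diag f F fhat k v j : continuous f ->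
  (forall x : R, is_derive x 1 F (f x)) -> dg_space M k v -> j \in cells M ->
  Aform M f fhat j v v =
  (flux_at M fhat v j * trl M v j - F (trl M v j))
  - (flux_at M fhat v (j - 1) * trr M v (j - 1) - F (trr M v (j - 1))).
Proof.
move=> cf dF vk jM; have [p _ vp] := dg_space_cell M_mesh vk jM.
have lt := cell_lt jM; rewrite /Aform.
have cfp : continuous (fun x => f p.[x] * p^`().[x]).
  move=> x; apply: continuousM; last exact: continuous_horner.
  by apply: continuous_comp; [exact: continuous_horner|exact: cf].
have dFp (x : R) : is_derive x 1 (F \o horner p) (f p.[x] * p^`().[x]).
  apply: is_derive1_comp; rewrite derivE derive1E.
have -> : \int[Leb]_(x in cell M j) (f (v x) * derive1 v x) =
    F (trl M v j) - F (trr M v (j - 1)).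
  rewrite (trlE lt vp) (trrE lt vp) -(FTC2_Rintegral (ltW lt) cfp dFp) -Rintegral_oo_cc//.
  apply: eq_Rintegral => x; rewrite inE => xj; rewrite vp// derivE !derive1E.
  (* The cell is open, so [v] and [p] agree near each of its points and have the same derivative
     there. *)
  congr (_ * _); apply: near_eq_derive.
  apply: (filterS vp); apply: open_nbhs_nbhs; split => //; exact: interval_open.
ring.
Qed.

Lemma sum_Aform_diag f fhat k v : continuous f -> dg_space M k v ->
  \sum_(j <- cells M) Aform M f fhat j v v =
  \sum_(j <- cells M) Theta M f fhat v j.
Proof.
move=> cf vk; have [F dF] := continuous_primitive cf.
pose G j := flux_at M fhat v j * trr M v j - F (trr M v j).
(* In the periodic case both traces agree at the two ends. In the compact case both right traces
   vanish, which kills the flux terms and leaves [- F 0] at each end. *)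
have GN : G (- (ghosts M)%:Z) = G ((ncell M)%:Z + (ghosts M)%:Z).
  move: (trace_wrap M_mesh vk); rewrite /ghosts /G /flux_at.
  by case: (bc M) => -[e1 e2]; rewrite ?oppr0 ?addr0 ?e1 ?e2 ?mulr0.
under eq_big_seq => j jM do rewrite (Aform_diag fhat cf dF vk jM).
rewrite sumrB (big_cells_shift GN) -sumrB; apply: eq_bigr => j _.
by rewrite /Theta (oriented_integral_sub_cst _ _ _ cf dF) /G; ring.
Qed.

(** Omega is the union of its open cells up to finitely many nodes, and the ghost cells add zero. *)
Lemma l2dot_cells h v : (forall j x, j \in cells M -> ~~ (1 <= j <= (ncell M)%:Z) ->
    cell M j x -> v x = 0) ->
  (forall j, 1 <= j <= (ncell M)%:Z ->
    Leb.-integrable (cell M j) (EFin \o (fun x => h x * v x))) ->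
  l2dot M h v = \sum_(j <- cells M) \int[Leb]_(x in cell M j) (h x * v x).
Proof.
move=> v0 ihv; rewrite big_cells_Omega => [|j jM jN]; last first.
  transitivity (\int[Leb]_(x in cell M j) (0 : R)).
    by apply: eq_Rintegral => x; rewrite inE => /(v0 _ _ jM jN) ->; rewrite mulr0.
  by rewrite Rintegral_cst ?mul0r//; exact: measurable_itv.
case: M_mesh => _ _ [n0 nN] _ _; rewrite /l2dot /Omega -n0 -nN.
have cellS i : cell M i.+1%:Z = `]node M i%:Z, node M i.+1%:Z[%classic.
  by rewrite /cell (_ : i.+1%:Z - 1 = i%:Z)//; lia.
have jN i : (i < ncell M)%N -> 1 <= i.+1%:Z <= (ncell M)%:Z by lia.
have jM i : (i < ncell M)%N -> i.+1%:Z \in cells M.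
  by move=> /jN; rewrite mem_cells; lia.
have [i|i iN|ico eco] := @Rintegral_co_sum _ (fun i => node M i%:Z) (ncell M) (fun x => h x * v x).
- move=> /jM/cell_lt; rewrite (_ : i.+1%:Z - 1 = i%:Z)//; lia.
- by rewrite -cellS; apply/ihv/jN.
under eq_bigr => i _ do rewrite cellS.
rewrite -eco Rintegral_itv_obnd_cbnd//.
by apply: integrableS ico => //; exact: subset_itv_oo_co.
Qed.

(** Meant for the source term, which is only square integrable: on each cell it is multiplied by a
    polynomial. *)
Lemma l2dot_dg k h v : dg_space M k v -> square_integrable M h ->
  l2dot M h v = \sum_(j <- cells M) \int[Leb]_(x in cell M j) (h x * v x).
Proof.
move=> vk [mh ih]; apply: l2dot_cells => [j x|j jN]; first exact: (dg_space_ghost M_mesh vk).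
have jM : j \in cells M by rewrite mem_cells; lia.
have [p _ vp] := dg_space_cell M_mesh vk jM.
have subO : cell M j `<=` Omega M.
  case: M_mesh => _ _ [n0 nN] _ _; rewrite /cell /Omega.
  apply: subset_itv; rewrite bnd_simp -?n0 -?nN (node_le M_mesh)//; lia.
have : Leb.-integrable (cell M j) (fun x => (h x * p.[x])%:E).
  apply: integrable_mul_poly.
    by apply: (measurable_funS _ subO mh); exact: measurable_itv.
  by apply: integrableS ih => //; exact: measurable_itv.
apply: eq_integrable => [|x]; first exact: measurable_itv.
by rewrite inE => xj /=; rewrite vp.
Qed.

Lemma l2norm_sqr_cells k v : dg_space M k v ->
  l2norm M v ^+ 2 = \sum_(j <- cells M) \int[Leb]_(x in cell M j) (v x * v x).
Proof.
move=> vk; rewrite /l2norm sqr_sqrtr; last first.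
  by apply: Rintegral_ge0 => x _; rewrite -expr2 sqr_ge0.
apply: l2dot_cells => [j x|j jN]; first exact: (dg_space_ghost M_mesh vk).
have jM : j \in cells M by rewrite mem_cells; lia.
have [p _ vp] := dg_space_cell M_mesh vk jM.
have : Leb.-integrable (cell M j) (EFin \o (fun x => p.[x] * p.[x])).
  by apply: continuous_integrable_oo => x; apply: continuousM; exact: continuous_horner.
apply: eq_integrable => [|x]; first exact: measurable_itv.
by rewrite inE => xj /=; rewrite vp.
Qed.

(** Membership in the DG space is assumed near [t], because the squared norm must equal the cell sum
    on a neighbourhood of [t] for their derivatives to agree. *)
Lemma is_derive_l2norm_sqr k (u : R -> R -> R) t :
  (\forall s \near t, dg_space M k (u s)) ->
  (forall j x, j \in cells M -> cell M j x -> derivable (u ^~ x) t 1) ->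
  is_derive t 1 (fun s => l2norm M (u s) ^+ 2)
    (2 * \sum_(j <- cells M)
       \int[Leb]_(x in cell M j) (derive1 (u ^~ x) t * u t x)).
Proof.
move=> uk du; have : is_derive t 1
    (fun s => \sum_(j <- cells M) \int[Leb]_(x in cell M j) (u s x * u s x))
    (2 * \sum_(j <- cells M)
       \int[Leb]_(x in cell M j) (derive1 (u ^~ x) t * u t x)).
  rewrite mulr_sumr; apply: is_derive_bigsum => j jM.
  apply: (@is_derive_integral_poly_sqr _ _ _ _ _ k.+1 (cell_lt jM)) => [|x xj].
    apply: filterS uk => s us; exact: (dg_space_cell M_mesh us jM).
  exact: du xj.
apply: near_eq_is_derive; apply: filterS uk => s us.
by rewrite (l2norm_sqr_cells us).
Qed.

End EnergyIdentity.

Theorem theorem3p3 (R : realType) (M : mesh R) (nu : R) (k : nat)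
    (gamma : R -> R) (sch : scheme) (mu sigma : R)
    (f : R -> R) (fhat : R -> R -> R)
    (Bj : int -> (R -> R) -> (R -> R) -> R) (fs u : R -> R -> R)
    (M_mesh : mesh_axioms nu M)
    (gamma_kernel : nonlocal_kernel (delta M) gamma)
    (mu_gt0 : 0 < mu)
    (fhat_flux : monotone_flux f fhat)
    (Bj_split : elementwise_split M k (Bform M gamma sch mu) Bj)
    (fs_L2 : forall t : R, 0 < t -> square_integrable M (fs t))
    (u_sol : semidiscrete_solution M k f fhat sigma Bj fs u) :
  forall t : R, 0 < t ->
  [/\ derivable (fun tau => l2norm M (u tau) ^+ 2) t 1,
      2^-1 * derive1 (fun tau => l2norm M (u tau) ^+ 2) t
        + \sum_(j <- cells M) Theta M f fhat (u t) j
        + sigma * Bform M gamma sch mu (u t) (u t)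
      = l2dot M (fs t) (u t) &
      forall j : int, j \in cells M -> 0 <= Theta M f fhat (u t) j].
Proof.
move=> t t0; have [uk du scheme_t] := u_sol t t0.
have uk_near : \forall s \near t, dg_space M k (u s).
  (* Times near a positive [t] are positive, so the scheme holds for them too. *)
  by apply: filterS (lt_nbhsr t0) => s /u_sol[].
have [dE dEE] := is_derive_l2norm_sqr M_mesh uk_near du.
split => // [|j _]; last exact: monotone_flux_entropy fhat_flux.
rewrite derive1E dEE mulKf// -(sum_Aform_diag M_mesh _ (monotone_flux_continuous fhat_flux) uk).
(* With every global term written as a sum over cells, what remains on each cell is the scheme
   tested with [u t]. *)
rewrite -(Bj_split _ _ uk uk) mulr_sumr -!big_split (l2dot_dg M_mesh uk (fs_L2 _ t0)).
by apply: eq_big_seq => j jM; exact: scheme_t.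
Qed.
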